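(* Let $\Phi=(\varphi_n)_n$ and $\Psi=(\psi_n)_n$ be two frames for $\mathcal H$ and let $\Phi^{ad}=(\varphi_n^{ad})_n$ be a fixed approximately dual frame of $\Phi$. If $\Phi-\Psi$ is a Bessel sequence with sufficiently small bound $M_{\Phi-\Psi}$, then there exists an approximately dual frame $\Psi^{ad}=(\psi_n^{ad})_n$ of $\Psi$ such that $\Phi^{ad}-\Psi^{ad}$ is also a Bessel sequence and its bound is a multiple of $M_{\Phi-\Psi}$. In particular, $T_\Phi U_{\Phi^{ad}}=T_\Psi U_{\Psi^{ad}}$.
   Context: $\mathcal H$ is a separable Hilbert space and $Id_{\mathcal H}$ is the identity operator on it. A sequence $\Phi=(\varphi_n)_{n\in\mathbb N}$ in $\mathcal H$ is a frame with frame bounds $m_\Phi,M_\Phi>0$ if $m_\Phi\|f\|^2\le\sum_{n}|\langle f,\varphi_n\rangle|^2\le M_\Phi\|f\|^2$ for all $f\in\mathcal H$; it is a Bessel sequence with (Bessel) bound $M_\Phi$ if only the second inequality is required. For a Bessel sequence $\Phi$, the analysis operator is $U_\Phi:\mathcal H\to\ell^2$, $U_\Phi f=(\langle f,\varphi_n\rangle)_n$, and the synthesis operator is $T_\Phi:\ell^2\to\mathcal H$, $T_\Phi((c_n)_n)=\sum_n c_n\varphi_n$. Two Bessel sequences $\Phi$ and $\Phi^{ad}$ are approximately dual frames if $\|Id_{\mathcal H}-T_\Phi U_{\Phi^{ad}}\|<1$ or $\|Id_{\mathcal H}-T_{\Phi^{ad}}U_\Phi\|<1$. The notation $\Phi-\Psi$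 (resp. $\Phi^{ad}-\Psi^{ad}$) denotes the sequence $(\varphi_n-\psi_n)_n$ (resp. $(\varphi_n^{ad}-\psi_n^{ad})_n$). *)

(* Defs.v *)
From HB Require Import structures.
From mathcomp Require Import all_boot all_order all_algebra.
From mathcomp Require Import sesquilinear complex.
From mathcomp Require Import all_classical all_reals all_analysis.

Set Implicit Arguments.
Unset Strict Implicit.
Unset Printing Implicit Defensive.

Import Order.TTheory GRing.Theory Num.Theory.
Import numFieldNormedType.Exports.

Local Open Scope classical_set_scope.
Local Open Scope ring_scope.

(* Hilbert spaces are taken over the reals or over the complex numbers. *)
Inductive scalar_kind := RealScalars | ComplexScalars.

Definition scalars (k : scalar_kind) (R : realType) : numFieldType :=
  match k with RealScalars => R | ComplexScalars => R[i] end.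

Definition conj_scalar (k : scalar_kind) (R : realType) :
    scalars k R -> scalars k R :=
  match k with RealScalars => idfun | ComplexScalars => @conjc R end.

Definition re_scalar (k : scalar_kind) (R : realType) : scalars k R -> R :=
  match k return scalars k R -> R with
  | RealScalars => fun x => x
  | ComplexScalars => @complex.Re R
  end.

Arguments conj_scalar : clear implicits.

(* The norm of a normed module over [K] takes its (real) values in [K];
   [rnorm] is the same norm, with values in [R]. *)
Definition rnorm (k : scalar_kind) (R : realType)
  (V : normedZmodType (scalars k R)) (x : V) : R := re_scalar `|x|.

Definition separable (T : topologicalType) : Prop :=
  exists2 D : set T, countable D & dense D.

Section Frames.
Context {R : realType} {k : scalar_kind}.
Context {H : completeNormedModType (scalars k R)}.
Variable ip : {dot H for conj_scalar k R}.

(* With completeness of [H], this makes ([H], [ip]) a Hilbert space; [ip] is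
   linear in its first argument and conjugate-linear in the second. *)
Definition induces_norm : Prop := forall x : H, ip x x = `|x| ^+ 2.

Definition opnorm (A : H -> H) : \bar R :=
  ereal_sup [set (rnorm (A f))%:E | f in [set f | rnorm f <= 1]].

Definition ell2 : set (nat -> scalars k R) :=
  [set c | (\sum_(0 <= n <oo) (rnorm (c n) ^+ 2)%:E < +oo)%E].

Definition bessel_bound (phi : nat -> H) (M : R) : Prop :=
  0 < M /\ forall f : H,
    (\sum_(0 <= n <oo) (rnorm (ip f (phi n)) ^+ 2)%:E
       <= (M * rnorm f ^+ 2)%:E)%E.

Definition bessel (phi : nat -> H) : Prop := exists M : R, bessel_bound phi M.

Definition frame_bounds (phi : nat -> H) (m M : R) : Prop :=
  [/\ 0 < m, bessel_bound phi M &
    forall f : H, ((m * rnorm f ^+ 2)%:E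
       <= \sum_(0 <= n <oo) (rnorm (ip f (phi n)) ^+ 2)%:E)%E].

Definition frame (phi : nat -> H) : Prop :=
  exists m M : R, frame_bounds phi m M.

Definition analysis (phi : nat -> H) (f : H) : nat -> scalars k R :=
  fun n => ip f (phi n).

Lemma analysis_ell2 (phi : nat -> H) (f : H) :
  bessel phi -> ell2 (analysis phi f).
Proof. by case=> M [_ /(_ f) leM]; apply: le_lt_trans leM (ltry _). Qed.

(* Only meaningful for a Bessel sequence [phi] and [c] in [ell2], where the
   series converges. *)
Definition synthesis (phi : nat -> H) (c : nat -> scalars k R) : H :=
  limn (series (fun n => c n *: phi n)).

Definition approx_dual (phi phi_ad : nat -> H) : Prop :=
  [/\ bessel phi, bessel phi_ad &
    (opnorm (idfun \- (synthesis phi \o analysis phi_ad))%R < 1)%E \/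
    (opnorm (idfun \- (synthesis phi_ad \o analysis phi))%R < 1)%E].

End Frames.

(* Main.v *)
(** Write [A] for the mixed operator of [phi] and [phi_ad], and [B] for that of
    [psi] and [phi_ad].  Passing to adjoints if necessary, [|Id - A| <= q < 1];
    since [|A - B|^2] is at most [M] times the Bessel bound of [phi_ad], for
    small [M] both [B] and its adjoint [D] are invertible by Neumann's argument,
    with inverses bounded by a constant independent of [psi].  Solving
    [D y_n = phi_ad n] and putting [psi_ad n = A* y_n] makes the analysis
    operator of [psi_ad] the composite of that of [phi_ad] with [B^-1 A].  Hence
    the mixed operator of [psi] and [psi_ad] is [B B^-1 A = A], and the analysis
    operator of [phi_ad - psi_ad] is that of [phi_ad] composed with
    [B^-1 (B - A)], whose square norm is a multiple of [M].  Mixed operators are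
    adjoint to each other, so Riesz representation is not needed. *)

Require Import Defs.
From HB Require Import structures.
From mathcomp Require Import all_boot all_order all_algebra.
From mathcomp Require Import sesquilinear complex.
From mathcomp Require Import all_classical all_reals all_analysis.
From mathcomp Require Import ring lra.

Set Implicit Arguments.
Unset Strict Implicit.

Import Order.TTheory GRing.Theory Num.Theory.
Import numFieldNormedType.Exports.

Local Open Scope ring_scope.

(** * Scalars: the real and complex cases treated uniformly *)

Definition of_real (k : scalar_kind) (R : realType) : R -> scalars k R :=
  match k return R -> scalars k R with
  | RealScalars => fun x => x
  | ComplexScalars => real_complex R
  end.
Arguments of_real k {R} _.

Section Scalars.
Context {R : realType} {k : scalar_kind}.
Implicit Types (x y : R) (a b : scalars k R).

Lemma of_realK x : re_scalar (of_real k x) = x.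
Proof. by case: k. Qed.

(** In [R[i]] a nonnegative element is real, so norms lose nothing when read in [R]. *)
Lemma ge0_re_scalarK a : 0 <= a -> of_real k (re_scalar a) = a.
Proof.
by case: k a => //= a a0; apply: RRe_real; rewrite realE a0.
Qed.

Lemma of_realD : {morph of_real k : x y / x + y : R >-> x + y}.
Proof. by case: k => // x y; exact: (raddfD (real_complex R)). Qed.

Lemma of_realM : {morph of_real k : x y / x * y : R >-> x * y}.
Proof. by case: k => // x y; exact: (rmorphM (real_complex R)). Qed.

Lemma of_real_le x y : (of_real k x <= of_real k y) = (x <= y).
Proof. by case: k => //=; rewrite lecR. Qed.

Lemma of_real0 : of_real k (0 : R) = 0.
Proof. by case: k. Qed.

Lemma of_real_lt x y : (of_real k x < of_real k y) = (x < y).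
Proof. by case: k => //=; rewrite ltcR. Qed.

Lemma mul_conj_scalar a : a * conj_scalar k R a = `|a| ^+ 2.
Proof.
by case: k a => /= a; [rewrite -expr2 real_normK ?num_real | rewrite sqr_normc].
Qed.

Lemma norm_conj_scalar a : `|conj_scalar k R a| = `|a|.
Proof. by case: k a => //= a; exact: normcJ. Qed.

End Scalars.

(** * Norms with real values *)

Section RealNorm.
Context {R : realType} {k : scalar_kind}.

Section Normed.
Context {V : normedZmodType (scalars k R)}.
Implicit Types x y : V.

Lemma normE x : `|x| = of_real k (rnorm x).
Proof. by rewrite ge0_re_scalarK. Qed.

Lemma rnorm_ge0 x : 0 <= rnorm x.
Proof. by rewrite -(of_real_le (k := k)) of_real0 -normE. Qed.

Lemma rnorm0 : rnorm (0 : V) = 0.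
Proof. by rewrite /rnorm normr0 -of_real0 of_realK. Qed.

Lemma rnorm_eq0 x : rnorm x = 0 -> x = 0.
Proof. by move=> x0; apply/normr0_eq0; rewrite normE x0 of_real0. Qed.

Lemma rnorm_gt0 x : x != 0 -> 0 < rnorm x.
Proof. by rewrite -(of_real_lt (k := k)) of_real0 -normE normr_gt0. Qed.

Lemma ler_rnormD x y : rnorm (x + y) <= rnorm x + rnorm y.
Proof. by rewrite -(of_real_le (k := k)) of_realD -!normE ler_normD. Qed.

Lemma rnormN x : rnorm (- x) = rnorm x.
Proof. by rewrite /rnorm normrN. Qed.

Lemma rdistC x y : rnorm (x - y) = rnorm (y - x).
Proof. by rewrite /rnorm distrC. Qed.

Lemma rdist_triangle z x y : rnorm (x - y) <= rnorm (x - z) + rnorm (z - y).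
Proof. by rewrite -[x - y](subrKA z) ler_rnormD. Qed.

End Normed.

Lemma rnormM (a b : scalars k R) : rnorm (a * b) = rnorm a * rnorm b.
Proof.
by rewrite -[RHS](of_realK (k := k)) of_realM -!normE -normrM.
Qed.

Lemma rnormZ (V : normedModType (scalars k R)) a (x : V) :
  rnorm (a *: x) = rnorm a * rnorm x.
Proof.
by rewrite -[RHS](of_realK (k := k)) of_realM -!normE -normrZ.
Qed.

Lemma rnorm_of_real (x : R) : 0 <= x -> rnorm (of_real k x) = x.
Proof.
by move=> x0; rewrite /rnorm ger0_norm ?of_realK// -of_real0 of_real_le.
Qed.

Lemma rnorm_conj (a : scalars k R) : rnorm (conj_scalar k R a) = rnorm a.
Proof. by rewrite /rnorm norm_conj_scalar. Qed.

Lemma ler_rnorm_sum (V : normedZmodType (scalars k R)) (I : Type) (r : seq I)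
    (F : I -> V) :
  rnorm (\sum_(i <- r) F i) <= \sum_(i <- r) rnorm (F i).
Proof.
elim/big_rec2: _ => [|i y x _ h]; first by rewrite rnorm0.
by apply: le_trans (ler_rnormD _ _) _; rewrite lerD2l.
Qed.

End RealNorm.

(** * Limits controlled by real-valued distances *)

Section Cauchy.
Local Open Scope classical_set_scope.
Context {R : realType} {k : scalar_kind}.
Context {V : completeNormedModType (scalars k R)}.
Implicit Types (u : nat -> V) (e : nat -> R).

Lemma cvg_of_dist u e (l : V) : e @ \oo --> (0 : R) ->
  (forall n, rnorm (l - u n) <= e n) -> u @ \oo --> l.
Proof.
move=> e0 ue; apply/cvgrPdist_lt => d d0.
(* The radius [d] is a positive scalar, hence real; its real part is the radius used in [R]. *)
have d'0 : 0 < re_scalar d.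
  by rewrite -(of_real_lt (k := k)) of_real0 ge0_re_scalarK// ltW.
move/cvgrPdist_lt: e0 => /(_ _ d'0); apply: filterS => n.
rewrite sub0r normrN => en; rewrite normE -(ge0_re_scalarK (ltW d0)).
by rewrite of_real_lt (le_lt_trans (ue n))// (le_lt_trans (ler_norm _)).
Qed.

Lemma cvg_dist u (l : V) : u @ \oo --> l ->
  (fun n => rnorm (l - u n)) @ \oo --> (0 : R).
Proof.
move=> ul; apply/cvgrPdist_lt => d d0; move/cvgrPdist_lt: ul => /(_ (of_real k d)).
rewrite -of_real0 of_real_lt => /(_ d0); apply: filterS => n.
by rewrite normE of_real_lt sub0r normrN ger0_norm ?rnorm_ge0.
Qed.

Lemma cauchy_limit u e : e @ \oo --> (0 : R) ->
  (forall m n, (m <= n)%N -> rnorm (u n - u m) <= e m) ->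
  u @ \oo --> limn u.
Proof.
move=> e0 ue; apply/cauchy_cvgP/cauchy_exP => d d0.
have d'0 : 0 < re_scalar d.
  by rewrite -(of_real_lt (k := k)) of_real0 ge0_re_scalarK// ltW.
move/cvgrPdist_lt: e0 => /(_ _ d'0)[N _ /(_ N (leqnn N))/=].
rewrite sub0r normrN => eN; exists (u N); exists N => // n /= Nn.
rewrite -ball_normE /ball_/= normE -(ge0_re_scalarK (ltW d0)) of_real_lt rdistC.
by rewrite (le_lt_trans (ue _ _ Nn))// (le_lt_trans (ler_norm _)).
Qed.

End Cauchy.

(** * Inner product and the Cauchy-Schwarz inequality *)

Section InnerProduct.
Context {R : realType} {k : scalar_kind}.
Context {H : completeNormedModType (scalars k R)}.
Variable ip : {dot H for conj_scalar k R}.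
Hypothesis ip_norm : induces_norm ip.
Implicit Types x y z : H.

Lemma ip_conj x y : ip x y = conj_scalar k R (ip y x).
Proof. by rewrite (hermitian_subproof (s := ip)) expr0 mul1r. Qed.

Lemma ipBr x y z : ip x (y - z) = ip x y - ip x z.
Proof. exact: linearBr. Qed.

Lemma ipBl x y z : ip (x - y) z = ip x z - ip y z.
Proof. exact: linearBl. Qed.

Lemma ip_suml (I : Type) (r : seq I) (F : I -> H) y :
  ip (\sum_(i <- r) F i) y = \sum_(i <- r) ip (F i) y.
Proof. exact: linear_sumlz. Qed.

Lemma ip_sumr (I : Type) (r : seq I) x (F : I -> H) :
  ip x (\sum_(i <- r) F i) = \sum_(i <- r) ip x (F i).
Proof. exact: linear_sumr. Qed.

Lemma ipZr a x y : ip x (a *: y) = conj_scalar k R a * ip x y.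
Proof. by rewrite linearZr_LR. Qed.

Lemma ipZl a x y : ip (a *: x) y = a * ip x y.
Proof. by rewrite linearZl_LR. Qed.

Lemma ip_inj x y : (forall z, ip z x = ip z y) -> x = y.
Proof.
move=> h; apply/eqP; rewrite -subr_eq0 -normr_eq0 -sqrf_eq0 -ip_norm.
by rewrite ipBr h subrr.
Qed.

Lemma rnorm_sqr x : rnorm x ^+ 2 = rnorm (ip x x).
Proof. by rewrite ip_norm !expr2 rnormM normE rnorm_of_real ?rnorm_ge0. Qed.

(** The square norm of [<y,y> x - <x,y> y] factors as [<y,y> (<y,y><x,x> - |<x,y>|^2)], and the
    positive factor [<y,y>] cancels. *)
Lemma cauchy_schwarz x y : rnorm (ip x y) <= rnorm x * rnorm y.
Proof.
have [->|y0] := eqVneq y 0; first by rewrite linear0r !rnorm0 mulr0.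
have n0 : 0 < ip y y by exact: neq0_dnorm_gt0.
have yc : conj_scalar k R (ip y y) = ip y y by rewrite -ip_conj.
set c := ip x y.
have : 0 <= ip (ip y y *: x - c *: y) (ip y y *: x - c *: y).
  by rewrite ip_norm exprn_ge0.
rewrite ipBr !ipBl !ipZr !ipZl yc (ip_conj y x) -/c.
have -> : ip y y * (ip y y * ip x x) - ip y y * (c * conj_scalar k R c)
   - (conj_scalar k R c * (ip y y * c) - conj_scalar k R c * (c * ip y y))
   = ip y y * (ip y y * ip x x - c * conj_scalar k R c) by ring.
rewrite pmulr_rge0// subr_ge0 mul_conj_scalar !ip_norm -exprMn.
rewrite ler_pXn2r ?nnegrE ?mulr_ge0// mulrC !normE -of_realM of_real_le.
exact.
Qed.

End InnerProduct.

(** * Bessel sequences, synthesis and mixed operators *)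

Section Bessel.
Local Open Scope classical_set_scope.
Context {R : realType} {k : scalar_kind}.
Context {H : completeNormedModType (scalars k R)}.
Variable ip : {dot H for conj_scalar k R}.
Hypothesis ip_norm : induces_norm ip.
Implicit Types (f g : H) (phi psi : nat -> H) (c : nat -> scalars k R).

(** Replaces the extended-real series by finite sums in [R], where the later estimates take
    place. *)
Lemma bessel_boundP phi M : 0 < M ->
  (bessel_bound ip phi M <-> forall f n,
    \sum_(0 <= i < n) rnorm (ip f (phi i)) ^+ 2 <= M * rnorm f ^+ 2).
Proof.
move=> M0; split=> [[_ h] f n|h]; last split=> // f.
  rewrite -lee_fin; apply: le_trans (h f); rewrite -sumEFin.
  by apply: nneseries_lim_ge => i _ _; rewrite lee_fin sqr_ge0.
apply: lime_le; first by apply: is_cvg_nneseries => i _ _; rewrite lee_fin sqr_ge0.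
by apply: nearW => n; rewrite sumEFin lee_fin.
Qed.

(* AM-GM with weight [M]: [2 |c| |<x, phi>| <= M |c|^2 + |<x, phi>|^2 / M]. *)
Lemma bessel_sum_le phi M c m n : bessel_bound ip phi M ->
  rnorm (\sum_(m <= i < n) c i *: phi i) ^+ 2
    <= M * \sum_(m <= i < n) rnorm (c i) ^+ 2.
Proof.
move=> hM; have M0 := hM.1; move/(bessel_boundP _ M0): hM => hM.
have [nm|mn] := leqP n m; first by rewrite !big_geq// rnorm0 expr0n mulr0.
set x := \sum_(m <= i < n) _.
have hx : \sum_(m <= i < n) rnorm (ip x (phi i)) ^+ 2 <= M * rnorm x ^+ 2.
  apply: le_trans (hM x n); rewrite [leRHS](big_cat_nat (n := m)) ?(ltnW mn)//=.
  by rewrite lerDr sumr_ge0// => i _; rewrite sqr_ge0.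
have : rnorm x ^+ 2 <= \sum_(m <= i < n) rnorm (c i) * rnorm (ip x (phi i)).
  rewrite (rnorm_sqr ip_norm) {1}/x ip_suml.
  apply: le_trans (ler_rnorm_sum _ _) _; apply: ler_sum => i _.
  by rewrite ipZl rnormM (ip_conj ip (phi i)) rnorm_conj.
move=> h.
have {}h : rnorm x ^+ 2 <= \sum_(m <= i < n)
    (M / 2 * rnorm (c i) ^+ 2 + (2 * M)^-1 * rnorm (ip x (phi i)) ^+ 2).
  apply: le_trans h _; apply: ler_sum => i _.
  rewrite -subr_ge0.
  have -> : forall a b : R, M / 2 * a ^+ 2 + (2 * M)^-1 * b ^+ 2 - a * b
    = (M * a - b) ^+ 2 / (2 * M) by move=> a b; field; rewrite gt_eqF.
  by rewrite divr_ge0 ?sqr_ge0 ?mulr_ge0// ltW.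
rewrite big_split/= -!mulr_sumr in h.
(* The Bessel inequality at [x] itself bounds the second half by [|x|^2 / 2], which the left-hand
   side absorbs. *)
have : (2 * M)^-1 * \sum_(m <= i < n) rnorm (ip x (phi i)) ^+ 2 <= rnorm x ^+ 2 / 2.
  apply: (@le_trans _ _ ((2 * M)^-1 * (M * rnorm x ^+ 2))).
    by rewrite ler_wpM2l// invr_ge0 mulr_ge0// ltW.
  by rewrite le_eqVlt; apply/orP; left; apply/eqP; field; rewrite gt_eqF.
lra.
Qed.

Section Synthesis.
Variables (phi : nat -> H) (M : R) (c : nat -> scalars k R) (B : R).
Hypothesis phiM : bessel_bound ip phi M.
Hypothesis cB : forall n, \sum_(0 <= i < n) rnorm (c i) ^+ 2 <= B.

(** By [bessel_sum_le], a block starting at [m] has square norm at most [M] times the tail of the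
    convergent series of [|c n|^2]; this is a Cauchy rate. *)
Lemma synthesis_cvg : series (fun n => c n *: phi n) @ \oo --> synthesis phi c.
Proof.
have M0 := phiM.1.
pose a := series (fun n => rnorm (c n) ^+ 2).
have a_nd : nondecreasing_seq a.
  by apply: nondecreasing_series => i _ _; rewrite sqr_ge0.
have a_cvg : cvgn a.
  by apply: nondecreasing_is_cvgn => //; exists B => _ [n _ <-]; exact: cB.
apply: (@cauchy_limit _ _ _ _ (fun n => Num.sqrt (M * (limn a - a n)))).
  rewrite -[X in _ --> X](sqrtr0 R) -[X in Num.sqrt X](mulr0 M).
  rewrite -[X in M * X](subrr (limn a)).
  apply: (@continuous_cvg _ _ _ _ _ _ Num.sqrt); first exact: sqrt_continuous.
  by apply: cvgM; [exact: cvg_cst | apply: cvgB => //; exact: cvg_cst].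
move=> m n mn; rewrite -[leLHS]ger0_norm ?rnorm_ge0// -sqrtr_sqr ler_wsqrtr//.
rewrite sub_series_geq// (le_trans (bessel_sum_le _ _ _ phiM))//.
rewrite ler_pM2l// -sub_series_geq// lerD2r.
exact: nondecreasing_cvgn_le.
Qed.

(** Partial sums [s] satisfy the bound, and [|l| <= |l - s| + sqrt (M * B)] passes it to the limit
    [l]. *)
Lemma synthesis_le : rnorm (synthesis phi c) ^+ 2 <= M * B.
Proof.
have M0 := phiM.1.
have B0 : 0 <= B by have := cB 0; rewrite big_nil.
rewrite -(sqr_sqrtr (mulr_ge0 (ltW M0) B0)).
rewrite ler_pXn2r ?nnegrE ?sqrtr_ge0 ?rnorm_ge0//.
have d0 := cvg_dist synthesis_cvg.
have : (fun n => rnorm (synthesis phi c - series (fun n => c n *: phi n) n)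
  + Num.sqrt (M * B)) @ \oo --> 0 + Num.sqrt (M * B).
  by apply: cvgD => //; exact: cvg_cst.
rewrite add0r => h; rewrite -(cvg_lim _ h)//; apply: limr_ge.
  by apply/cvg_ex; eexists; exact: h.
apply: nearW => n; set s := series _ n.
rewrite -[synthesis phi c in leLHS](subrK s) (le_trans (ler_rnormD _ _))// lerD2l.
rewrite -[leLHS]ger0_norm ?rnorm_ge0// -sqrtr_sqr ler_wsqrtr//.
by rewrite (le_trans (bessel_sum_le _ _ _ phiM))// ler_pM2l.
Qed.

End Synthesis.

Lemma synthesis_analysis_cvg phi psi f : bessel ip phi -> bessel ip psi ->
  series (fun n => ip f (psi n) *: phi n) @ \oo
    --> synthesis phi (analysis ip psi f).
Proof.
move=> [M phiM] [N psiN]; apply: (synthesis_cvg phiM).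
by have /bessel_boundP := psiN; apply; exact: psiN.1.
Qed.

Lemma synthesis_analysis_le phi psi M N f :
  bessel_bound ip phi M -> bessel_bound ip psi N ->
  rnorm (synthesis phi (analysis ip psi f)) ^+ 2 <= M * N * rnorm f ^+ 2.
Proof.
move=> phiM psiN; rewrite -mulrA; apply: synthesis_le phiM _.
by have /bessel_boundP := psiN; apply; exact: psiN.1.
Qed.

Lemma synthesis_analysisB phi phi' psi f :
  bessel ip phi -> bessel ip phi' -> bessel ip psi ->
  synthesis (fun n => phi n - phi' n) (analysis ip psi f)
    = synthesis phi (analysis ip psi f) - synthesis phi' (analysis ip psi f).
Proof.
move=> b b' bpsi; apply: cvg_lim => //.
have -> : series (fun n => analysis ip psi f n *: (phi n - phi' n)) =
    (fun n => series (fun n => ip f (psi n) *: phi n) n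
        - series (fun n => ip f (psi n) *: phi' n) n).
  apply/funext => n; rewrite /series/= -sumrB.
  by apply: eq_bigr => i _; rewrite scalerBr.
by apply: cvgB; exact: synthesis_analysis_cvg.
Qed.

(** The identity is exact for partial sums of both sides; Cauchy-Schwarz makes the two remainders
    vanish in the limit. *)
Lemma synthesis_analysis_adj phi psi f g : bessel ip phi -> bessel ip psi ->
  ip (synthesis phi (analysis ip psi f)) g
    = ip f (synthesis psi (analysis ip phi g)).
Proof.
move=> bphi bpsi.
set x := synthesis _ _; set y := synthesis _ _.
pose s n := series (fun n => ip f (psi n) *: phi n) n.
pose t n := series (fun n => ip g (phi n) *: psi n) n.
have st n : ip (s n) g = ip f (t n).
  rewrite /s /t /series /= ip_suml ip_sumr; apply: eq_bigr => i _.
  by rewrite ipZl ipZr -ip_conj mulrC.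
have hs := cvg_dist (synthesis_analysis_cvg (f := f) bphi bpsi).
have ht := cvg_dist (synthesis_analysis_cvg (f := g) bpsi bphi).
apply/eqP; rewrite -subr_eq0; apply/eqP/rnorm_eq0/eqP.
rewrite eq_le rnorm_ge0 andbT.
have h : (fun n => rnorm (x - s n) * rnorm g + rnorm f * rnorm (y - t n)) @ \oo
    --> 0 * rnorm g + rnorm f * 0.
  by apply: cvgD; apply: cvgM => //; exact: cvg_cst.
rewrite mul0r mulr0 addr0 in h.
rewrite -(cvg_lim _ h)//; apply: limr_ge.
  by apply/cvg_ex; eexists; exact: h.
apply: nearW => n.
have -> : ip x g - ip f y = ip (x - s n) g - ip f (y - t n).
  by rewrite ipBl ipBr st opprB addrA subrK.
rewrite (le_trans (ler_rnormD _ _))// rnormN lerD//; exact: cauchy_schwarz.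
Qed.

End Bessel.

(** * Operators close to the identity and Neumann inversion *)

Section NearIdentity.
Local Open Scope classical_set_scope.
Context {R : realType} {k : scalar_kind}.
Context {H : completeNormedModType (scalars k R)}.
Implicit Types (A B : H -> H) (q : R) (x y z : H).

(** Pointwise form of [||Id - A|| <= q], kept in [R]; linearity of [A] is supplied separately. *)
Definition near_id A q := forall x, rnorm (x - A x) <= q * rnorm x.

(** For [q < 1] this bounds the inverse of [A] by [1 / (1 - q)]. *)
Lemma near_id_lower A q x : near_id A q -> (1 - q) * rnorm x <= rnorm (A x).
Proof.
move=> Aq; have := ler_rnormD (x - A x) (A x); rewrite subrK; have := Aq x; lra.
Qed.

(** The iterates of the contraction [y |-> z + (y - A y)] from 0 are the partial sums of the Neumann
    series at [z]. *)
Lemma near_id_surjective A q : {morph A : x y / x - y} -> 0 <= q < 1 ->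
  near_id A q -> forall z, exists y, A y = z.
Proof.
move=> AB /andP[q0 q1] Aq z.
pose u n := iter n (fun y => z + (y - A y)) 0.
have uS n : u n.+1 = z + (u n - A (u n)) by [].
have step n : rnorm (u n.+1 - u n) <= rnorm z * q ^+ n.
  elim: n => [|n IH].
    have A0 : A 0 = 0 by rewrite -[in LHS](subrr (0 : H)) AB subrr.
    by rewrite uS /u /= A0 !subr0 addr0 expr0 mulr1.
  rewrite (uS n.+1) [in X in _ - X](uS n) opprD addrACA subrr add0r.
  have -> : u n.+1 - A (u n.+1) - (u n - A (u n))
      = (u n.+1 - u n) - A (u n.+1 - u n).
    by rewrite AB !opprD !opprK addrACA.
  by rewrite (le_trans (Aq _))// exprS mulrCA ler_wpM2l.
(* The factor [1 - q] telescopes the geometric sum of the increments. *)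
have tele m n : (m <= n)%N ->
    (1 - q) * rnorm (u n - u m) <= rnorm z * (q ^+ m - q ^+ n).
  elim: n => [|n IH].
    by rewrite leqn0 => /eqP ->; rewrite !subrr rnorm0 !mulr0.
  rewrite leq_eqVlt => /predU1P[<-|]; first by rewrite !subrr rnorm0 !mulr0.
  rewrite ltnS => /IH {}IH.
  have h := rdist_triangle (u n) (u n.+1) (u m).
  have : (1 - q) * rnorm (u n.+1 - u m)
    <= (1 - q) * (rnorm (u n.+1 - u n) + rnorm (u n - u m)).
    by rewrite ler_wpM2l// subr_ge0 ltW.
  have : (1 - q) * rnorm (u n.+1 - u n) <= (1 - q) * (rnorm z * q ^+ n).
    by rewrite ler_wpM2l// subr_ge0 ltW.
  rewrite exprS; lra.
have q1' : 0 < 1 - q by rewrite subr_gt0.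
have eto0 : geometric (rnorm z / (1 - q)) q @ \oo --> (0 : R).
  by apply: cvg_geometric; rewrite ger0_norm.
have ulim : u @ \oo --> limn u.
  apply: (cauchy_limit eto0) => m n mn.
  rewrite -(ler_pM2l q1') (le_trans (tele _ _ mn))//.
  have -> : (1 - q) * geometric (rnorm z / (1 - q)) q m = rnorm z * q ^+ m.
    by rewrite /geometric/=; field; rewrite gt_eqF.
  by rewrite ler_wpM2l ?rnorm_ge0// gerBl exprn_ge0.
exists (limn u); set y := limn u.
have Au n : A (u n) = z - (u n.+1 - u n).
  by rewrite uS addrA addrAC addrK subKr.
(* Two limits of [A (u n)] are compared: [A y], since [|A w| <= (1 + q) |w|], and [z], since the
   increments of [u] vanish. *)
have h : A \o u @ \oo --> A y.
  have d0 : (fun n => (1 + q) * rnorm (y - u n)) @ \oo --> (0 : R).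
    by rewrite -(mulr0 (1 + q)); apply: cvgM; [exact: cvg_cst | exact: cvg_dist].
  apply: (cvg_of_dist d0) => n /=; rewrite -AB; set w := y - u n.
  have := ler_rnormD (A w - w) w; rewrite subrK (rdistC (A w)); have := Aq w; lra.
have h' : A \o u @ \oo --> z.
  have {1}-> : z = z - (y - y) by rewrite subrr subr0.
  have -> : A \o u = (fun n => z - (u n.+1 - u n)) by apply/funext => n; exact: Au.
  apply: cvgB; first exact: cvg_cst.
  by apply: cvgB => //; rewrite (cvg_shiftS u).
exact: cvg_unique h h'.
Qed.

(** The operator norm, finite because below 1, serves as [q]; rescaling to unit norm extends the
    bound from the unit ball to all vectors. *)
Lemma opnorm_lt1 A : (forall a x, A (a *: x) = a *: A x) ->
  (opnorm (fun x => (x - A x)%R) < 1)%E -> exists2 q, 0 <= q < 1 & near_id A q.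
Proof.
move=> AZ; set D := fun x => x - A x => D1.
have ub x : rnorm x <= 1 -> ((rnorm (D x))%:E <= opnorm D)%E.
  by move=> x1; apply: ereal_sup_ubound; exists x.
have D0 : (0 <= opnorm D)%E.
  by apply: le_trans (ub 0 _); rewrite ?lee_fin ?rnorm_ge0// rnorm0.
have Dfin : opnorm D \is a fin_num by rewrite ge0_fin_numE// (lt_trans D1)// ltry.
exists (fine (opnorm D)).
  by rewrite fine_ge0//= -lte_fin fineK.
move=> x; have [->|x0] := eqVneq x 0.
  have -> : A 0 = 0 by have := AZ 0 0; rewrite !scale0r.
  by rewrite subr0 rnorm0 mulr0.
have nx := rnorm_gt0 x0.
pose a := of_real k (rnorm x)^-1.
have an : rnorm a = (rnorm x)^-1 by rewrite rnorm_of_real// invr_ge0 ltW.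
have := ub (a *: x); rewrite rnormZ an mulVf ?gt_eqF// => /(_ (lexx _)).
rewrite /D AZ -scalerBr rnormZ an -{1}(fineK Dfin) lee_fin.
by rewrite ler_pdivrMl// mulrC.
Qed.

Lemma near_id_opnorm A q : q < 1 -> 0 <= q -> near_id A q ->
  (opnorm (fun x => (x - A x)%R) < 1)%E.
Proof.
move=> q1 q0 Aq; apply: (@le_lt_trans _ _ q%:E); last by rewrite lte_fin.
apply: ge_ereal_sup => _ [x /= x1 <-]; rewrite lee_fin (le_trans (Aq x))//.
by rewrite -[leRHS]mulr1 ler_wpM2l.
Qed.

(** * Adjoint pairs *)

Section Adjoint.
Variable ip : {dot H for conj_scalar k R}.
Hypothesis ip_norm : induces_norm ip.

Definition adjoint A B := forall x y, ip (A x) y = ip x (B y).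

Lemma adjoint_sym A B : adjoint A B -> adjoint B A.
Proof. by move=> AB x y; rewrite ip_conj -AB -ip_conj. Qed.

(** Having an adjoint forces additivity, as inner products separate points; mixed operators thus get
    their linearity from [synthesis_analysis_adj]. *)
Lemma adjointB A B : adjoint A B -> {morph A : x y / x - y}.
Proof.
move=> /adjoint_sym AB x y; apply: (ip_inj ip_norm) => z.
by rewrite -AB !ipBr !AB.
Qed.

Lemma adjointZ A B a x : adjoint A B -> A (a *: x) = a *: A x.
Proof.
move=> /adjoint_sym AB; apply: (ip_inj ip_norm) => z.
by rewrite -AB !ipZr AB.
Qed.

(** For [w = x - B x], adjointness gives [|w|^2 = <w - A w, x> <= q |w| |x|]. *)
Lemma adjoint_near_id A B q : adjoint A B -> near_id A q -> near_id B q.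
Proof.
move=> AB Aq x; set w := x - B x.
have [->|w0] := eqVneq w 0.
  rewrite rnorm0; have := Aq x; have := rnorm_ge0 (x - A x); lra.
have nw := rnorm_gt0 w0.
rewrite -(ler_pM2l nw) -expr2 (rnorm_sqr ip_norm).
have -> : ip w w = ip (w - A w) x by rewrite [in X in ip _ X]/w ipBr -AB ipBl.
rewrite (le_trans (cauchy_schwarz ip_norm _ _))//.
by rewrite mulrCA mulrA ler_wpM2r ?rnorm_ge0.
Qed.

End Adjoint.
End NearIdentity.

(** * Perturbation of approximately dual frames *)

Unset Implicit Arguments.

Theorem theorem2p8 (R : realType) (k : scalar_kind)
    (H : completeNormedModType (scalars k R))
    (ip : {dot H for conj_scalar k R}) (ip_norm : induces_norm ip)
    (sepH : separable H)
    (phi phi_ad : nat -> H) (frame_phi : frame ip phi)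
    (ad_phi : approx_dual ip phi phi_ad) :
  exists eps C : R, [/\ 0 < eps, 0 < C &
    forall (psi : nat -> H) (M : R),
      frame ip psi ->
      bessel_bound ip (fun n => phi n - psi n) M -> M < eps ->
      exists psi_ad : nat -> H,
        [/\ approx_dual ip psi psi_ad,
            bessel_bound ip (fun n => phi_ad n - psi_ad n) (C * M) &
            synthesis phi \o analysis ip phi_ad
              = synthesis psi \o analysis ip psi_ad]].
Proof.
case: ad_phi => b_phi b_ad near_or.
pose op (a b : nat -> H) := synthesis a \o analysis ip b.
have op_adj a b : bessel ip a -> bessel ip b -> adjoint ip (op a b) (op b a).
  by move=> ba bb x y; exact: synthesis_analysis_adj.
pose A := op phi phi_ad; pose A' := op phi_ad phi.
have AA' : adjoint ip A A' by exact: op_adj.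
have A'A := adjoint_sym AA'.
have [q /andP[q0 q1] Aq] : exists2 q, 0 <= q < 1 & near_id A q.
  case: near_or => lt1.
    exact: (opnorm_lt1 (A := A) (fun a x => adjointZ ip_norm a x AA') lt1).
  have [q q01 A'q] :=
    opnorm_lt1 (A := A') (fun a x => adjointZ ip_norm a x A'A) lt1.
  by exists q => //; exact: (adjoint_near_id ip_norm A'A).
have [N adN] := b_ad; have N0 := adN.1.
(* Half of the gap [1 - q] is spent on [|A - B| <= d]; the other half keeps [B] within [1 - d] of
   the identity. *)
have [d qE d0] : exists2 d, q = 1 - 2 * d & 0 < d.
  by exists ((1 - q) / 2); [field | rewrite divr_gt0// subr_gt0].
(* The first value makes [M * N <= d ^+ 2]. In the second, one [N] comes from [|A - B|^2], the other
   from the Bessel bound of [phi_ad], and [d ^+ 2] from inverting [B]. *)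
exists (d ^+ 2 / N), (N ^+ 2 / d ^+ 2); split.
- by rewrite divr_gt0// exprn_gt0.
- by rewrite divr_gt0// exprn_gt0.
move=> psi M [m [M' [_ psiM' _]]] diffM Meps; have M0 := diffM.1.
have b_psi : bessel ip psi by exists M'.
pose B := op psi phi_ad; pose D := op phi_ad psi.
have BD : adjoint ip B D by exact: op_adj.
(* [A - B] is the mixed operator of [phi - psi] and [phi_ad]. *)
have AB x : rnorm (A x - B x) ^+ 2 <= M * N * rnorm x ^+ 2.
  rewrite -[A x - B x](synthesis_analysisB (ip := ip))//.
  exact: synthesis_analysis_le.
have Bq : near_id B (1 - d).
  move=> x; have := Aq x; have := rdist_triangle (A x) x (B x).
  have : rnorm (A x - B x) <= d * rnorm x.
    rewrite -(@ler_pXn2r _ 2)// ?nnegrE ?mulr_ge0 ?rnorm_ge0 ?(ltW d0)//.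
    rewrite exprMn (le_trans (AB x))// ler_wpM2r ?sqr_ge0//.
    by rewrite -ler_pdivlMr// ltW.
  rewrite qE; lra.
have q01 : 0 <= 1 - d < 1 by apply/andP; split; lra.
have Dq := adjoint_near_id ip_norm BD Bq.
have B_onto := near_id_surjective (adjointB ip_norm BD) q01 Bq.
have D_onto := near_id_surjective (adjointB ip_norm (adjoint_sym BD)) q01 Dq.
have [y Dy] := choice (fun n => D_onto (phi_ad n)).
have [g Bg] := choice (fun f => B_onto (A f)).
(* Here [g] plays the role of [B^-1 A]: [<f, A' y_n> = <A f, y_n> = <B (g f), y_n> = <g f, D
   y_n>]. *)
have psi_adE f n : ip f (A' (y n)) = ip (g f) (phi_ad n).
  by rewrite -AA' -Bg -Dy BD.
have eqAB : A = op psi (fun n => A' (y n)).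
  apply/funext => f; rewrite -Bg /B /op /=; congr synthesis.
  by apply/funext => n; rewrite /analysis psi_adE.
(* [B (f - g f) = B f - A f], and [B] is bounded below by [d]. *)
have fg f : d ^+ 2 * rnorm (f - g f) ^+ 2 <= M * N * rnorm f ^+ 2.
  rewrite (le_trans _ (AB f))// (rdistC (A f)) -Bg -(adjointB ip_norm BD) -exprMn.
  rewrite ler_pXn2r ?nnegrE ?mulr_ge0 ?rnorm_ge0 ?(ltW d0)//.
  by have := near_id_lower (f - g f) Bq; rewrite subKr.
have CM0 : 0 < N ^+ 2 / d ^+ 2 * M by rewrite !mulr_gt0 ?invr_gt0 ?exprn_gt0.
have diff_ad : bessel_bound ip (fun n => phi_ad n - A' (y n)) (N ^+ 2 / d ^+ 2 * M).
  apply/bessel_boundP => // f n.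
  have -> : \sum_(0 <= i < n) rnorm (ip f (phi_ad i - A' (y i))) ^+ 2
     = \sum_(0 <= i < n) rnorm (ip (f - g f) (phi_ad i)) ^+ 2.
    by apply: eq_bigr => i _; rewrite ipBr psi_adE -ipBl.
  have /(bessel_boundP _ _ N0) /(_ (f - g f) n) h := adN.
  apply: le_trans h _.
  have -> : N ^+ 2 / d ^+ 2 * M * rnorm f ^+ 2
    = N * ((M * N * rnorm f ^+ 2) / d ^+ 2) by field; rewrite gt_eqF.
  by rewrite ler_pM2l// ler_pdivlMr ?exprn_gt0// mulrC.
exists (fun n => A' (y n)); split => //.
split=> //; last first.
  (* The new mixed operator is [A], so the first alternative holds with the same [q], whichever one
     was given for [phi]. *)
  left; rewrite -/(op psi _) -eqAB.
  by apply: (near_id_opnorm (q := q)).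
(* From [|g f|^2 <= 2 |f|^2 + 2 |f - g f|^2] and [fg], times the Bessel bound [N] of [phi_ad]. *)
exists (N * (2 + 2 * (N * M / d ^+ 2))).
have K0 : 0 < N * (2 + 2 * (N * M / d ^+ 2)).
  by rewrite mulr_gt0// addr_gt0// mulr_gt0// divr_gt0 ?mulr_gt0// exprn_gt0.
apply/bessel_boundP => // f n.
under eq_bigr => i _ do rewrite psi_adE.
have /(bessel_boundP _ _ N0) /(_ (g f) n) h := adN.
apply: le_trans h _; rewrite -[leRHS]mulrA ler_pM2l//.
have gf : rnorm (g f) <= rnorm f + rnorm (f - g f).
  by have := ler_rnormD (g f - f) f; rewrite subrK rdistC addrC.
have : rnorm (g f) ^+ 2 <= (rnorm f + rnorm (f - g f)) ^+ 2.
  by rewrite ler_pXn2r ?nnegrE ?addr_ge0 ?rnorm_ge0.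
have : rnorm (f - g f) ^+ 2 <= N * M / d ^+ 2 * rnorm f ^+ 2.
  by rewrite mulrAC ler_pdivlMr ?exprn_gt0// mulrC (mulrC N).
have := sqr_ge0 (rnorm f - rnorm (f - g f)).
nra.
Qed.
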